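(* Consider the Curie-Weiss model on $\Lambda=\{-1,1\}^n$: $\sigma=(\sigma_1,\ldots,\sigma_n)$ is random with probability mass function $$p(\sigma)=\frac{\exp(H(\sigma))}{Z(\beta,h)},\qquad H(\sigma)=\frac{\beta}{n}\sum_{1\le i<j\le n}\sigma_i\sigma_j+h\sum_{i=1}^n\sigma_i,\qquad Z(\beta,h)=\sum_{\sigma\in\Lambda}\exp(H(\sigma)).$$ Let $m(\sigma)=\frac1n\sum_{i=1}^n\sigma_i$ be the average magnetization. If $0\le\beta<1$ and $h\ge0$, then for all $t\ge0$, $$\mathbb{P}(m(\sigma)\ge\mathbb{E}(m(\sigma))+t)\le\exp\left(-\frac{n(1-\beta)t^2}{16\left(1-\tanh(h)+4/((1-\beta)\sqrt n)\right)}\right),$$ $$\mathbb{P}(m(\sigma)\le\mathbb{E}(m(\sigma))-t)\le\exp\left(-\frac{n(1-\beta)t^2}{4\left[1-\tanh(h)+4/((1-\beta)\sqrt n)\right]+4t}\right).$$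
   Context: All probabilities and expectations are with respect to the law $p$ of $\sigma$. *)

(* Defs.v *)
From HB Require Import structures.
From mathcomp Require Import all_boot all_order all_algebra.
From mathcomp Require Import all_classical all_reals all_analysis.

Set Implicit Arguments.
Unset Strict Implicit.
Unset Printing Implicit Defensive.

Import Order.TTheory GRing.Theory Num.Theory.
Local Open Scope ring_scope.

Definition tanh (R : realType) (x : R) : R :=
  (expR x - expR (- x)) / (expR x + expR (- x)).

(* {-1, 1}^n, with [true] standing for 1 and [false] for -1. *)
Definition config (n : nat) : finType := {ffun 'I_n -> bool}.

Definition spin (R : realType) (n : nat) (s : config n) (i : 'I_n) : R :=
  if s i then 1 else -1.

(* Signed as in exp(+H): this is minus the physical energy. *)
Definition hamiltonian (R : realType) (n : nat) (beta h : R) (s : config n) : R :=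
  beta / n%:R * (\sum_(i < n) \sum_(j < n | (i < j)%N) spin R s i * spin R s j)
  + h * \sum_(i < n) spin R s i.

Definition partition_function (R : realType) (n : nat) (beta h : R) : R :=
  \sum_(s : config n) expR (hamiltonian beta h s).

Definition gibbs (R : realType) (n : nat) (beta h : R) (s : config n) : R :=
  expR (hamiltonian beta h s) / partition_function n beta h.

Definition gibbs_prob (R : realType) (n : nat) (beta h : R)
    (A : pred (config n)) : R :=
  \sum_(s : config n | A s) gibbs beta h s.

Definition gibbs_expect (R : realType) (n : nat) (beta h : R)
    (f : config n -> R) : R :=
  \sum_(s : config n) gibbs beta h s * f s.

Definition magnetization (R : realType) (n : nat) (s : config n) : R :=
  n%:R^-1 * \sum_(i < n) spin R s i.

(* Main.v *)
(* Let j be the number of minus spins; its law is proportional to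
   exp (2 (beta / n) j ^ 2 + l j) for a suitable l, and tilting it by exp (u j)
   only changes l into l + u.  For every l, heat-bath dynamics (whose drift is
   monotone because the logistic function is 1/4-Lipschitz) and Chebyshev's
   sum inequality give (1 - beta) Var j <= E j.  Read along the tilts, this
   says that the logarithmic derivative of u |-> E_u j is at most
   c = 1 / (1 - beta), so that
     log E exp (u (j - E j)) <= E j (exp (c u) - 1 - c u) / c,
   and Chernoff's bound yields Poisson-type tails in terms of
   E j = n (1 - E m) / 2.  Finally E m >= tanh h, since the interaction favours
   large values of |m|. *)

Require Import Defs.
From mathcomp Require Import all_boot all_order all_algebra.
From mathcomp Require Import all_classical all_reals all_analysis.
From mathcomp Require Import ring lra.

Set Implicit Arguments.
Unset Strict Implicit.
Unset Printing Implicit Defensive.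

Import Order.TTheory GRing.Theory Num.Theory.
Local Open Scope ring_scope.
Import numFieldNormedType.Exports.

(** * Monotonicity by derivatives, and two exponential inequalities *)

Lemma ge0_derive_le (R : realType) (f df : R -> R) (a b : R) :
  a <= b -> (forall x, is_derive x (1 : R) f (df x)) ->
  (forall x, a <= x <= b -> 0 <= df x) -> f a <= f b.
Proof.
move=> ab fdf df0.
have cf : {within `[a, b], continuous f}%classic.
  by apply: derivable_within_continuous => x _; case: (fdf x).
have [c + E] := MVT_segment ab (fun x _ => fdf x) cf.
rewrite in_itv /= => /df0 dc0.
by rewrite -subr_ge0 E mulr_ge0 // subr_ge0.
Qed.

(** The derivative of the logistic function has size e^z / (1 + e^z)^2, which is at most 1/4 because
    (1 - e^z)^2 >= 0. *)
Lemma logistic_lipschitz (R : realType) (x y : R) : x <= y ->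
  (1 + expR x)^-1 - (1 + expR y)^-1 <= (y - x) / 4.
Proof.
move=> xy.
pose f (z : R) := z * 4^-1 + (1 + expR z)^-1.
have pos z : 0 < 1 + expR z :> R by rewrite addr_gt0 ?expR_gt0.
suff : f x <= f y by rewrite /f; lra.
apply: (ge0_derive_le (df := fun z => 4^-1 - expR z / (1 + expR z) ^+ 2)) xy _ _ => z.
  have nz : 1 + expR z != 0 by rewrite gt_eqF.
  have d1 : is_derive z (1 : R) (fun u : R => 1 + expR u) (expR z).
    by apply: is_derive_eq; rewrite add0r mul1r.
  have d2 := @is_deriveV R (fun u : R => 1 + expR u) z _ _ nz d1.
  apply: is_derive_eq.
  rewrite /GRing.scale /=.
  by field.
move=> _; rewrite subr_ge0 ler_pdivrMr ?exprn_gt0 // mulrC ler_pdivlMr //.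
by have := sqr_ge0 (1 - expR z); lra.
Qed.

(** The difference of the two sides vanishes at 0 and has derivative 2 z (e^z - 1) >= 0. The right
    tail needs this form, with [1 - x] multiplying the exponential. *)
Lemma expR_le_geom (R : realType) (x : R) : 0 <= x ->
   2 * (1 - x) * expR x <= 2 - x ^+ 2.
Proof.
move=> x0.
pose f (z : R) := 2 - z ^+ 2 - 2 * (1 - z) * expR z.
suff : f 0 <= f x by rewrite /f expR0; lra.
apply: (ge0_derive_le (df := fun z => 2 * z * (expR z - 1))) x0 _ _ => z.
  apply: is_derive_eq.
  rewrite /GRing.scale /=.
  by ring.
by move=> /andP[z0 _]; rewrite !mulr_ge0 // subr_ge0 -expR0 ler_expR.
Qed.

(** * Laplace transforms and the sub-Poisson bound *)

Section laplace.
Context (R : realType) (T : finType).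
Implicit Types (w X : T -> R) (u : R) (k : nat).

Definition laplace w X k u : R := \sum_s w s * X s ^+ k * expR (u * X s).

Lemma is_derive_laplace w X k u :
  is_derive u (1 : R) (laplace w X k) (laplace w X k.+1 u).
Proof.
rewrite /laplace.
have -> : (fun u => \sum_s w s * X s ^+ k * expR (u * X s)) =
   \sum_s (fun u => w s * X s ^+ k * expR (u * X s)).
  by apply/funext => v; rewrite fct_sumE.
elim/big_ind2 : _ => [|f df g dg hf hg|s _].
- exact: is_derive_cst.
- exact: is_deriveD.
apply: is_derive_eq.
rewrite /GRing.scale /= exprS; ring.
Qed.

Lemma laplace_subpoisson w X (mu c : R) :
  0 < c -> (forall s, 0 < w s) -> (0 < #|T|)%N ->
  mu = laplace w X 1 0 / laplace w X 0 0 ->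
  (forall u, laplace w X 2 u * laplace w X 0 u - laplace w X 1 u ^+ 2
               <= c * (laplace w X 1 u * laplace w X 0 u)) ->
  forall u, laplace w X 0 u <= laplace w X 0 0 * expR (mu * (expR (c * u) - 1) / c).
Proof.
move=> c0 w0 T0 muE hvar.
have Z0 u : 0 < laplace w X 0 u.
  have [s0 _] := card_gt0P T0.
  rewrite /laplace (bigD1 s0) //= ltr_wpDr //.
    by apply: sumr_ge0 => s _; rewrite expr0 mulr1 mulr_ge0 ?expR_ge0 // ltW.
  by rewrite expr0 mulr1 mulr_gt0 ?expR_gt0.
(* [M u] is the mean of [X] under the tilted law times [expR (- (c * u))];
   the hypothesis says exactly that it is nonincreasing. *)
pose M (u : R) := laplace w X 1 u / laplace w X 0 u * expR (- (c * u)).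
have decM x y : x <= y -> M y <= M x.
  move=> xy; rewrite -lerN2.
  pose N (u : R) := - M u.
  apply: (ge0_derive_le (f := N) (df := fun u =>
    (c * (laplace w X 1 u * laplace w X 0 u)
     - (laplace w X 2 u * laplace w X 0 u - laplace w X 1 u ^+ 2))
       / laplace w X 0 u ^+ 2 * expR (- (c * u)))) xy _ _ => z.
    have d0 := is_derive_laplace w X 0 z.
    have d1 := is_derive_laplace w X 1 z.
    have nz : laplace w X 0 z != 0 by rewrite gt_eqF.
    have d2 := @is_deriveV R (laplace w X 0) z _ _ nz d0.
    apply: is_derive_eq; rewrite /GRing.scale /=.
    by field.
  move=> _; rewrite mulr_ge0 ?expR_ge0 // divr_ge0 ?sqr_ge0 // subr_ge0; exact: hvar.
have muM : mu = M 0 by rewrite /M mulr0 oppr0 expR0 mulr1.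
(* [P] compares the transform with the claimed bound. Its derivative has the sign of [M u - mu],
   where [mu] is [M 0] and [M] is nonincreasing, so [P] is largest at 0. *)
pose P (u : R) := laplace w X 0 u * expR (- (mu * (expR (c * u) - 1) / c)).
pose dP (u : R) := (M u - mu) * (laplace w X 0 u * expR (c * u) *
                      expR (- (mu * (expR (c * u) - 1) / c))).
have dPE z : is_derive z (1 : R) P (dP z).
  have d0 := is_derive_laplace w X 0 z.
  apply: is_derive_eq; rewrite /GRing.scale /= /dP /M [expR (- (c * z))]expRN.
  have nz : laplace w X 0 z != 0 by rewrite gt_eqF.
  have ez : expR (c * z) != 0 by rewrite gt_eqF ?expR_gt0.
  have cz : c != 0 by rewrite gt_eqF.
  field. by rewrite nz ez cz.
have pos z : 0 <= laplace w X 0 z * expR (c * z) *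
                      expR (- (mu * (expR (c * z) - 1) / c)).
  by rewrite !mulr_ge0 ?expR_ge0 // ltW.
suff H u : P u <= P 0.
  move=> u; have := H u; rewrite /P mulr0 expR0 subrr mulr0 mul0r oppr0 expR0 mulr1.
  by rewrite expRN ler_pdivrMr ?expR_gt0.
have [u0|/ltW u0] := leP u 0.
  apply: (ge0_derive_le u0 dPE) => z /andP[_ z0].
  by rewrite mulr_ge0 // subr_ge0 muM decM.
rewrite -lerN2.
pose N (u : R) := - P u.
have dN z : is_derive z (1 : R) N (- dP z).
  by have d0 := dPE z; apply: is_derive_eq.
apply: (ge0_derive_le (f := N) u0 dN) => z /andP[z0 _].
by rewrite /dP -mulNr mulr_ge0 // opprB subr_ge0 muM decM.
Qed.

End laplace.

(** * Chernoff bounds for sub-Poisson variables *)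

Section tails.
Context (R : realType) (T : finType).
Variables (w X : T -> R) (mu c : R).
Hypotheses (c_gt0 : 0 < c) (mu_gt0 : 0 < mu) (w_ge0 : forall s, 0 <= w s)
  (subpoisson : forall u, laplace w X 0 u <=
     laplace w X 0 0 * expR (mu * (expR (c * u) - 1) / c)).

(** The sign of [u] is left free, so that one statement serves both tails: the first hypothesis
    bounds [X] from below if [u] is positive and from above if it is negative. *)
Lemma chernoff_subpoisson (A : pred T) (u a e : R) :
  (forall s, A s -> u * a <= u * X s) ->
  c * (- u * a) + mu * (expR (c * u) - 1) <= c * e ->
  \sum_(s | A s) w s <= (\sum_s w s) * expR e.
Proof.
move=> Aa ae.
have -> : \sum_s w s = laplace w X 0 0.
  by apply: eq_bigr => s _; rewrite mul0r expR0 expr0 !mulr1.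
apply: (@le_trans _ _ (expR (- u * a) * laplace w X 0 u)).
  rewrite mulr_sumr [leRHS](bigID A) /= -[leLHS]addr0 lerD //; last first.
    by apply: sumr_ge0 => s _; rewrite !mulr_ge0 ?expR_ge0.
  apply: ler_sum => s /Aa ua; rewrite expr0 mulr1 mulrCA -expRD.
  by rewrite ler_peMr // -expR0 ler_expR mulNr addrC subr_ge0.
apply: le_trans (ler_wpM2l (expR_ge0 _) (subpoisson u)) _.
rewrite mulrCA -expRD ler_wpM2l //.
  by apply: sumr_ge0 => s _; rewrite !mulr_ge0 ?expR_ge0.
rewrite ler_expR -(ler_pM2l c_gt0); apply: le_trans ae.
by rewrite le_eqVlt; apply/orP; left; apply/eqP; field; rewrite gt_eqF.
Qed.

Lemma subpoisson_right_tail (A : pred T) (x : R) : 0 <= x ->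
  (forall s, A s -> mu + x <= X s) ->
  \sum_(s | A s) w s <= (\sum_s w s) * expR (- (x ^+ 2 / (2 * c * (mu + x)))).
Proof.
move=> x0 Ax.
have y0 : 0 < mu + x by rewrite ltr_wpDr.
(* The optimal tilt is -ln (1 - k) / c; its first-order part [k / c] is used instead. As mu = (mu +
   x) (1 - k), [expR_le_geom] then bounds mu e^k. *)
pose k := x / (mu + x).
have k0 : 0 <= k by rewrite divr_ge0 // ltW.
apply: (@chernoff_subpoisson _ (k / c) (mu + x)).
  by move=> s As; rewrite ler_wpM2l ?divr_ge0 ?Ax // ltW.
have -> : c * (k / c) = k by rewrite mulrC divfK // gt_eqF.
have -> : c * (- (k / c) * (mu + x)) = - x by rewrite /k; field; rewrite !gt_eqF.
have -> : c * - (x ^+ 2 / (2 * c * (mu + x))) = - (x ^+ 2 / (2 * (mu + x))).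
  by field; rewrite !gt_eqF.
have E := expR_le_geom k0.
have : (mu + x) / 2 * (2 * (1 - k) * expR k) <= (mu + x) / 2 * (2 - k ^+ 2).
  by rewrite ler_wpM2l // divr_ge0 // ltW.
have -> : (mu + x) / 2 * (2 * (1 - k) * expR k) = mu * expR k.
  by rewrite {1}/k; field; rewrite gt_eqF.
have -> : (mu + x) / 2 * (2 - k ^+ 2) = mu + x - x ^+ 2 / (2 * (mu + x)).
  by rewrite /k; field; rewrite gt_eqF.
by lra.
Qed.

Lemma subpoisson_left_tail (A : pred T) (x : R) : 0 <= x ->
  (forall s, A s -> X s <= mu - x) ->
  \sum_(s | A s) w s <= (\sum_s w s) * expR (- (x ^+ 2 / (4 * c * mu))).
Proof.
move=> x0 Ax.
(* Once e^-k is bounded by 1 - k + k^2, the exponent times [c] is mu k^2 - k x, which this [k]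
   minimises. *)
pose k := x / (2 * mu).
have k0 : 0 <= k by rewrite divr_ge0 // mulr_ge0 // ltW.
apply: (@chernoff_subpoisson _ (- k / c) (mu - x)).
  by move=> s As; rewrite ler_wnM2l ?Ax // mulNr oppr_le0 divr_ge0 // ltW.
have -> : c * (- k / c) = - k by rewrite mulrC divfK // gt_eqF.
have -> : c * (- (- k / c) * (mu - x)) = k * (mu - x) by field; rewrite !gt_eqF.
have -> : c * - (x ^+ 2 / (4 * c * mu)) = - (x ^+ 2 / (4 * mu)).
  by field; rewrite !gt_eqF.
have E : expR (- k) <= 1 - k + k ^+ 2.
  have k1 : 0 < 1 + k by rewrite ltr_wpDr.
  rewrite expRN (le_trans (y := (1 + k)^-1)) ?lef_pV2 ?posrE ?expR_gt0 ?expR_ge1Dx //.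
  rewrite -div1r ler_pdivrMr //.
  have -> : (1 - k + k ^+ 2) * (1 + k) = 1 + k ^+ 3 by ring.
  by rewrite lerDl exprn_ge0.
have : mu * expR (- k) <= mu * (1 - k + k ^+ 2) by rewrite ler_wpM2l // ltW.
have -> : mu * (1 - k + k ^+ 2) = mu - x / 2 + x ^+ 2 / (4 * mu).
  by rewrite /k; field; rewrite gt_eqF.
have -> : k * (mu - x) = x / 2 - x ^+ 2 / (2 * mu) by rewrite /k; field; rewrite gt_eqF.
have -> : x ^+ 2 / (2 * mu) = 2 * (x ^+ 2 / (4 * mu)) by field; rewrite gt_eqF.
by lra.
Qed.

End tails.

(** Summing w s w s' (u s - u s') (v s - v s') >= 0 over all pairs gives twice the difference of the
    two sides. *)
Lemma chebyshev_sum (R : realDomainType) (T : finType) (w u v : T -> R) :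
  (forall s, 0 <= w s) ->
  (forall s s', 0 <= (u s - u s') * (v s - v s')) ->
  (\sum_s w s * u s) * (\sum_s w s * v s) <=
  (\sum_s w s * (u s * v s)) * \sum_s w s.
Proof.
move=> w0 uv.
have D f g : \sum_s \sum_s' (f s * g s' : R) = (\sum_s f s) * \sum_s g s.
  by rewrite big_distrlr.
have : 0 <= \sum_s \sum_s' w s * w s' * ((u s - u s') * (v s - v s')).
  by apply: sumr_ge0 => s _; apply: sumr_ge0 => s' _; apply: mulr_ge0 => //; apply: mulr_ge0.
have -> : \sum_s \sum_s' w s * w s' * ((u s - u s') * (v s - v s')) =
   \sum_s \sum_s' (w s * (u s * v s) * w s' + w s * (w s' * (u s' * v s'))
     - w s * u s * (w s' * v s') - w s * v s * (w s' * u s')).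
  by do 2 (apply: eq_bigr => ? _); ring.
under eq_bigr do rewrite !big_split /= !sumrN.
by rewrite !big_split /= !sumrN !D; lra.
Qed.

(** * Spin flips and heat-bath rates *)

Section curie_weiss.
Context (R : realType) (n : nat).
Implicit Types (s : config n) (b l : R).

Definition minus s : nat := \sum_(i < n) ~~ s i.

Definition flip (i : 'I_n) s : config n := [ffun k => (k == i) (+) s k].

Lemma flipK i : involutive (flip i).
Proof. by move=> s; apply/ffunP => k; rewrite !ffunE addbA addbb. Qed.

Lemma minus_flip i s : s i -> minus (flip i s) = (minus s).+1.
Proof.
move=> si; rewrite /minus (bigD1 i) //= [in RHS](bigD1 i) //= ffunE eqxx si /=.
rewrite add1n add0n; congr _.+1; apply: eq_bigr => k /negPf ki.
by rewrite ffunE ki.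
Qed.

Lemma minus_le s : (minus s <= n)%N.
Proof.
rewrite -[leqRHS]card_ord -sum1_card; apply: leq_sum => i _; exact: leq_b1.
Qed.

(* Each configuration with a minus spin at [i] is the flip of one with a plus spin there. *)
Lemma minus_size_bias (G : nat -> R) :
  \sum_s (minus s)%:R * G (minus s) =
  \sum_s (n%:R - (minus s)%:R) * G (minus s).+1.
Proof.
transitivity (\sum_(i < n) \sum_(s : config n) (~~ s i)%:R * G (minus s)).
  rewrite exchange_big /=; apply: eq_bigr => s _.
  by rewrite natr_sum mulr_suml.
transitivity (\sum_(i < n) \sum_(s : config n) (s i)%:R * G (minus s).+1); last first.
  rewrite exchange_big /=; apply: eq_bigr => s _.
  rewrite -mulr_suml; congr (_ * _).
  rewrite /minus natr_sum; apply/eqP; rewrite eq_sym subr_eq -big_split /=.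
  rewrite -[X in X%:R == _]card_ord -sum1_card natr_sum; apply/eqP/eq_bigr => i _.
  by case: (s i); rewrite ?addr0 ?add0r.
apply: eq_bigr => i _; rewrite (reindex_inj (inv_inj (flipK i))) /=.
apply: eq_bigr => s _; rewrite ffunE eqxx /= negbK.
by case: (boolP (s i)) => [/minus_flip->//|_]; rewrite !mul0r.
Qed.

(* The Gibbs weight up to a constant factor, for [l = - (2 * b + 2 * h)]. *)
Definition weight b l (j : nat) : R := expR (2 * b / n%:R * j%:R ^+ 2 + l * j%:R).

Lemma weight_gt0 b l j : 0 < weight b l j.
Proof. exact: expR_gt0. Qed.

(* Heat-bath probability that a spin seeing [j] minus spins among the others is plus. *)
Definition plus_rate b l (j : nat) : R :=
  (1 + expR (2 * b / n%:R * (2 * j%:R + 1) + l))^-1.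

(** Detailed balance: the ratio of consecutive weights is exactly the exponential in [plus_rate]. *)
Lemma plus_rateP b l j :
  weight b l j.+1 * plus_rate b l j = weight b l j * (1 - plus_rate b l j).
Proof.
set e := expR (2 * b / n%:R * (2 * j%:R + 1) + l).
have -> : weight b l j.+1 = weight b l j * e.
  by rewrite /weight /e -expRD -natr1; congr expR; ring.
rewrite /plus_rate -/e; have e0 : 0 < e by exact: expR_gt0.
by field; rewrite gt_eqF // addr_gt0.
Qed.

Lemma plus_rate_le1 b l j : plus_rate b l j <= 1.
Proof. by rewrite invf_le1 ?addr_gt0 ?expR_gt0 // lerDl expR_ge0. Qed.

(** One more minus spin raises the logistic argument by 4 b / n, and the slope is at most 1/4. *)
Lemma plus_rate_lipschitz b l j : 0 <= b ->
  plus_rate b l j - plus_rate b l j.+1 <= b / n%:R.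
Proof.
move=> b0; apply: le_trans (logistic_lipschitz _) _.
  rewrite lerD2r ler_wpM2l ?divr_ge0 ?mulr_ge0 ?ler0n //.
  by rewrite lerD2r ler_wpM2l // ler_nat.
rewrite -[j.+1%:R]natr1; move: (n%:R^-1) => m.
by rewrite le_eqVlt; apply/orP; left; apply/eqP; field.
Qed.

(** Stationarity of the heat-bath dynamics: moves from j to j - 1 balance moves from j - 1 to j,
    tested against [f]. A minus spin sees one minus spin fewer than the total, hence [.-1]; at 0 the
    factor [(minus s)%:R] kills the truncated value. *)
Lemma weight_sum_bias b l (f : nat -> R) :
  \sum_s weight b l (minus s) * ((minus s)%:R * plus_rate b l (minus s).-1 * f (minus s)) =
  \sum_s weight b l (minus s) *
     ((n%:R - (minus s)%:R) * (1 - plus_rate b l (minus s)) * f (minus s).+1).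
Proof.
have := minus_size_bias (fun j => weight b l j * plus_rate b l j.-1 * f j).
under eq_bigr do rewrite !mulrA.
move=> E; under eq_bigr do rewrite !mulrA [weight b l _ * _]mulrC.
rewrite E; apply: eq_bigr => s _ /=.
by rewrite plus_rateP; ring.
Qed.

End curie_weiss.

(** * Monotonicity and parity of the hyperbolic tangent *)

Lemma le_tanh (R : realType) (x y : R) : x <= y -> tanh x <= tanh y.
Proof.
move=> xy; have p (z : R) : 0 < expR z + expR (- z) by rewrite addr_gt0 ?expR_gt0.
rewrite /tanh ler_pdivrMr // mulrAC ler_pdivlMr //.
have : expR (x - y) <= expR (y - x) by rewrite ler_expR; lra.
rewrite !expRD; move: (expR x) (expR (- x)) (expR y) (expR (- y)) => a a' b b' ab.
by rewrite -subr_ge0 (_ : _ - _ = 2 * (b * a' - a * b')) ?mulr_ge0 ?subr_ge0 //; ring.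
Qed.

Lemma tanh_ge0 (R : realType) (x : R) : 0 <= x -> 0 <= tanh x.
Proof. by move=> /le_tanh; rewrite {1}/tanh oppr0 subrr mul0r. Qed.

Lemma mul_tanh_even (R : realType) (h y : R) : y * tanh (h * y) = `|y| * tanh (h * `|y|).
Proof.
case: (ger0P y) => // _; rewrite /tanh mulrN opprK.
by move: (expR (h * y)) (expR (- (h * y))) => a b; rewrite [b + a]addrC; ring.
Qed.

(** * Variance of the number of minus spins and mean of the magnetization *)

Section magnetization_mean.
Context (R : realType) (n : nat).
Hypothesis n_gt0 : (0 < n)%N.
Implicit Types (s : config n) (b h l : R).

Let nR_gt0 : 0 < n%:R :> R. Proof. by rewrite ltr0n. Qed.

(** Under the normalised weights, stationarity tested against 1 and j gives E down = E up and Cov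
    (j, down - up) = E up, which is at most E j. Chebyshev's inequality bounds the same covariance
    below by (1 - b) Var j. *)
Lemma weight_variance b l : 0 <= b ->
  (1 - b) * ((\sum_s weight n b l (@minus n s) * (minus s)%:R ^+ 2)
               * (\sum_s weight n b l (@minus n s))
             - (\sum_s weight n b l (@minus n s) * (minus s)%:R) ^+ 2)
  <= (\sum_s weight n b l (@minus n s) * (minus s)%:R)
       * \sum_s weight n b l (@minus n s).
Proof.
move=> b0; pose W s := weight n b l (@minus n s); pose p := plus_rate n b l.
pose down j := j%:R * p j.-1; pose up j := (n%:R - j%:R) * (1 - p j).
pose psi j := down j - up j - (1 - b) * j%:R.
(* From j to j + 1, [down - up] grows by 1 minus n - 1 differences of consecutive rates, each at
   most b / n, hence by at least 1 - b. *)
have psi_step j : (j < n)%N -> psi j <= psi j.+1.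
  move=> jn; rewrite /psi /down /up /=.
  have h1 : (n%:R - j.+1%:R) * (p j - p j.+1) <= (n%:R - j.+1%:R) * (b / n%:R).
    by rewrite ler_wpM2l ?plus_rate_lipschitz // subr_ge0 ler_nat.
  have h2 : j%:R * (p j.-1 - p j) <= j%:R * (b / n%:R).
    by case: j {jn h1} => [|j]; rewrite ?mul0r // ler_wpM2l ?plus_rate_lipschitz.
  have h3 : n%:R * (b / n%:R) = b by field; rewrite gt_eqF.
  have h4 : 0 <= b / n%:R by rewrite divr_ge0.
  move: h1 h2; rewrite -[j.+1%:R]natr1.
  by lra.
have psi_homo j k : (j <= k)%N -> (k <= n)%N -> psi j <= psi k.
  elim: k => [|k IH]; first by rewrite leqn0 => /eqP->.
  rewrite leq_eqVlt => /orP[/eqP-> //|jk] kn.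
  exact: le_trans (IH jk (ltnW kn)) (psi_step _ kn).
have W0 s : 0 <= W s by rewrite ltW // weight_gt0.
have psi_cov s s' : 0 <= ((minus s)%:R - (minus s')%:R) * (psi (@minus n s) - psi (@minus n s')).
  case/orP: (leq_total (minus s) (minus s')) => ss'.
    by rewrite mulr_le0 // subr_le0 ?ler_nat // psi_homo // minus_le.
  by rewrite mulr_ge0 // subr_ge0 ?ler_nat // psi_homo // minus_le.
have := chebyshev_sum W0 psi_cov.
have E0 : \sum_s W s * down (minus s) = \sum_s W s * up (minus s).
  have := weight_sum_bias n b l (fun=> 1).
  by under eq_bigr do rewrite mulr1; under [in RHS]eq_bigr do rewrite mulr1.
(* The extra sum appears because an upward move from j is tested at j + 1. *)
have E1 : \sum_s W s * (down (minus s) * (minus s)%:R) =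
          \sum_s W s * (up (minus s) * (minus s)%:R) + \sum_s W s * up (minus s).
  have := weight_sum_bias n b l (fun j => j%:R).
  move=> ->; rewrite -big_split; apply: eq_bigr => s _ /=.
  by rewrite -natr1 /up /W /p; ring.
have E2 : \sum_s W s * down (minus s) <= \sum_s W s * (minus s)%:R.
  by apply: ler_sum => s _; rewrite ler_wpM2l // ler_piMr // plus_rate_le1.
have -> : \sum_s W s * psi (minus s) = - ((1 - b) * \sum_s W s * (minus s)%:R).
  rewrite -[RHS]add0r -[X in X - _](subrr (\sum_s W s * up (minus s))) -{1}E0.
  rewrite mulr_sumr -!sumrB; apply: eq_bigr => s _; rewrite /psi; ring.
have -> : \sum_s W s * ((minus s)%:R * psi (minus s)) =
    \sum_s W s * up (minus s) - (1 - b) * \sum_s W s * (minus s)%:R ^+ 2.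
  have -> : \sum_s W s * up (minus s) =
     \sum_s W s * (down (minus s) * (minus s)%:R) -
     \sum_s W s * (up (minus s) * (minus s)%:R) by rewrite E1; ring.
  rewrite mulr_sumr -!sumrB; apply: eq_bigr => s _; rewrite /psi; ring.
have SW0 : 0 <= \sum_s W s by apply: sumr_ge0.
have := ler_wpM2r SW0 E2; rewrite E0 -/W.
set a := \sum_s W s; set d := \sum_s W s * _; set e := \sum_s W s * _.
set f := \sum_s W s * _.
by rewrite !expr2; lra.
Qed.

Definition total_spin s : R := n%:R - 2 * (minus s)%:R.

Lemma sum_spin s : \sum_(i < n) spin R s i = total_spin s.
Proof.
rewrite /total_spin /minus natr_sum mulr_sumr -[X in X%:R - _]card_ord -sum1_card.
rewrite natr_sum -sumrB; apply: eq_bigr => i _; rewrite /spin.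
by case: (s i) => /=; lra.
Qed.

(** The squared total spin counts each pair twice, and its n diagonal terms equal 1; these produce
    the constant -b / 2. *)
Lemma hamiltonianE b h s : hamiltonian b h s =
  b / (2 * n%:R) * total_spin s ^+ 2 + h * total_spin s - b / 2.
Proof.
rewrite /hamiltonian sum_spin.
suff -> : total_spin s ^+ 2 =
    2 * (\sum_(i < n) \sum_(j < n | (i < j)%N) spin R s i * spin R s j) + n%:R.
  by field; rewrite gt_eqF.
pose c i j := spin R s i * spin R s j.
have -> : total_spin s ^+ 2 = \sum_(i < n) \sum_(j < n) c i j.
  by rewrite -sum_spin expr2 big_distrlr.
have -> : \sum_(i < n) \sum_(j < n) c i j =
  \sum_(i < n) (\sum_(j < n | (i < j)%N) c i j + \sum_(j < n | (j < i)%N) c i j + 1).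
  apply: eq_bigr => i _; rewrite (bigID (fun j : 'I_n => (i < j)%N)) /= -addrA; congr (_ + _).
  rewrite (bigD1 i) ?ltnn //= addrC; congr (_ + _).
    by apply: eq_bigl => j; rewrite -leqNgt andbC -ltn_neqAle.
  by rewrite /c /spin; case: (s i); lra.
rewrite !big_split /= sumr_const card_ord; congr (_ + _).
rewrite [X in _ + X](exchange_big_dep xpredT) //=.
suff -> : \sum_(j < n) \sum_(i < n | (j < i)%N) c i j =
     \sum_(i < n) \sum_(j < n | (i < j)%N) c i j by rewrite mulr_natl mulr2n.
by apply: eq_bigr => i _; apply: eq_bigr => j _; rewrite /c mulrC.
Qed.

Definition opposite s : config n := [ffun i => ~~ s i].

Lemma oppositeK : involutive opposite.
Proof. by move=> s; apply/ffunP => i; rewrite !ffunE negbK. Qed.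

Lemma total_spin_opposite s : total_spin (opposite s) = - total_spin s.
Proof.
rewrite -!sum_spin -sumrN; apply: eq_bigr => i _.
by rewrite /spin ffunE; case: (s i); rewrite /= ?opprK.
Qed.

(** Symmetrisation under the global spin flip, used to turn exponential weights into even ones. *)
Lemma sum_opposite (F : R -> R) :
  2 * \sum_s F (total_spin s) = \sum_s (F (total_spin s) + F (- total_spin s)).
Proof.
rewrite big_split /= mulr_natl mulr2n; congr (_ + _).
rewrite (reindex_inj (inv_inj oppositeK)) /=.
by apply: eq_bigr => s _; rewrite total_spin_opposite.
Qed.

Lemma mean_spin_free h :
  \sum_s total_spin s * expR (h * total_spin s) =
  n%:R * tanh h * \sum_s expR (h * total_spin s).
Proof.
pose G (j : nat) : R := expR (h * (n%:R - 2 * j%:R)).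
have GS j : G j.+1 = expR (- h) ^+ 2 * G j.
  by rewrite /G expr2 -!expRD -natr1; congr expR; ring.
have A := minus_size_bias n G.
set a := \sum_s _ in A.
set N := \sum_s expR (h * total_spin s).
(* The flip identity becomes a linear equation for the unnormalised mean number of minus spins, so
   no product structure has to be unfolded. *)
have {}A : a = expR (- h) ^+ 2 * (n%:R * N - a).
  rewrite {1}A /a /N mulr_sumr -sumrB mulr_sumr; apply: eq_bigr => s _.
  by rewrite GS /G /total_spin; ring.
have -> : \sum_s total_spin s * expR (h * total_spin s) = n%:R * N - 2 * a.
  rewrite /a /N !mulr_sumr -sumrB; apply: eq_bigr => s _.
  by rewrite /G /total_spin; ring.
have e0 : 0 < expR h by exact: expR_gt0.
have d0 : expR h ^+ 2 + 1 != 0 by rewrite gt_eqF // addr_gt0 // exprn_gt0.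
have -> : a = n%:R * N / (expR h ^+ 2 + 1).
  apply: (mulIf d0); rewrite divfK //.
  have : expR h ^+ 2 * a = expR h ^+ 2 * (expR (- h) ^+ 2 * (n%:R * N - a)).
    by rewrite -A.
  by rewrite mulrA -exprMn expRxMexpNx_1 expr1n; lra.
rewrite /tanh expRN; field.
by rewrite d0 gt_eqF.
Qed.

(* Conditioned on its absolute value y, the total spin has mean y tanh (h y), which like
   the interaction factor exp (k y ^ 2) increases with y: so the interaction can only
   increase the mean. *)
Lemma mean_spin_ge (k : R) h : 0 <= k -> 0 <= h ->
  n%:R * tanh h * \sum_s expR (k * total_spin s ^+ 2 + h * total_spin s) <=
  \sum_s total_spin s * expR (k * total_spin s ^+ 2 + h * total_spin s).
Proof.
move=> k0 h0.
(* [C] is the joint weight of y and -y without interaction, [A] the mean spin given the absolute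
   value, [F] the interaction; Chebyshev's inequality is applied to [A] and [F] under [C]. *)
pose C (y : R) := expR (h * y) + expR (- (h * y)).
pose A (y : R) := y * tanh (h * y).
pose F (y : R) := expR (k * y ^+ 2).
have C0 y : 0 < C y by rewrite addr_gt0 ?expR_gt0.
have CA y : C y * A y = y * expR (h * y) + - y * expR (h * - y).
  by rewrite /A /tanh -/(C y) mulrCA [C y * _]mulrC divfK ?gt_eqF // mulrN; ring.
have CE y : C y = expR (h * y) + expR (h * - y) by rewrite mulrN.
have mono y y' : `|y| <= `|y'| -> A y <= A y' /\ F y <= F y'.
  move=> yy; split; last first.
    by rewrite ler_expR ler_wpM2l // -[y ^+ 2]real_normK ?num_real //
      -[y' ^+ 2]real_normK ?num_real // lerXn2r ?nnegrE.
  rewrite /A (mul_tanh_even h y) (mul_tanh_even h y') ler_pM ?tanh_ge0 ?mulr_ge0 // le_tanh //.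
  by rewrite ler_wpM2l.
have cov s s' : 0 <= (A (total_spin s) - A (total_spin s')) *
                     (F (total_spin s) - F (total_spin s')).
  case/orP: (le_total `|total_spin s| `|total_spin s'|) => /mono[? ?].
    by rewrite mulr_le0 // subr_le0.
  by rewrite mulr_ge0 // subr_ge0.
have := chebyshev_sum (fun s => ltW (C0 (total_spin s))) cov.
have E1 : \sum_s C (total_spin s) = 2 * \sum_s expR (h * total_spin s).
  by rewrite (sum_opposite (fun y => expR (h * y))); apply: eq_bigr => s _; rewrite CE.
have E2 : \sum_s C (total_spin s) * A (total_spin s) =
    2 * \sum_s total_spin s * expR (h * total_spin s).
  by rewrite (sum_opposite (fun y => y * expR (h * y))); apply: eq_bigr => s _; rewrite CA.
have E3 : \sum_s C (total_spin s) * F (total_spin s) =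
    2 * \sum_s expR (k * total_spin s ^+ 2 + h * total_spin s).
  rewrite (sum_opposite (fun y => expR (k * y ^+ 2 + h * y))); apply: eq_bigr => s _.
  by rewrite CE /F sqrrN !expRD; ring.
have E4 : \sum_s C (total_spin s) * (A (total_spin s) * F (total_spin s)) =
    2 * \sum_s total_spin s * expR (k * total_spin s ^+ 2 + h * total_spin s).
  rewrite (sum_opposite (fun y => y * expR (k * y ^+ 2 + h * y))); apply: eq_bigr => s _.
  by rewrite mulrA CA /F sqrrN !expRD; ring.
rewrite E1 E2 E3 E4 mean_spin_free.
set z := \sum_s expR (h * _); set y := \sum_s expR _; set x := \sum_s _ * _.
have z0 : 0 < z.
  rewrite /z (bigD1 [ffun=> true]) //= ltr_wpDr ?expR_gt0 //.
  by apply: sumr_ge0 => *; exact: expR_ge0.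
move=> H; rewrite -(ler_pM2r (_ : 0 < 4 * z)); last by rewrite mulr_gt0.
by lra.
Qed.

Lemma gibbsE b h s : gibbs b h s =
  expR (b / (2 * n%:R) * total_spin s ^+ 2 + h * total_spin s) /
  \sum_s expR (b / (2 * n%:R) * total_spin s ^+ 2 + h * total_spin s).
Proof.
rewrite /gibbs /partition_function.
under eq_bigr do rewrite hamiltonianE expRD.
by rewrite hamiltonianE expRD -mulr_suml -mulf_div divff ?mulr1 // gt_eqF ?expR_gt0.
Qed.

Lemma gibbs_weightE b h s : gibbs b h s =
  weight n b (- (2 * b + 2 * h)) (minus s) /
  \sum_s weight n b (- (2 * b + 2 * h)) (@minus n s).
Proof.
rewrite gibbsE.
have E s' : expR (b / (2 * n%:R) * total_spin s' ^+ 2 + h * total_spin s') =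
   weight n b (- (2 * b + 2 * h)) (minus s') * expR (b * n%:R / 2 + h * n%:R).
  by rewrite -expRD; congr expR; rewrite /total_spin; field; rewrite gt_eqF.
under eq_bigr do rewrite E.
by rewrite E -mulr_suml -mulf_div divff ?mulr1 // gt_eqF ?expR_gt0.
Qed.

Lemma gibbs_sum1 b h : \sum_(s : config n) gibbs b h s = 1 :> R.
Proof.
under eq_bigr do rewrite gibbsE.
rewrite -mulr_suml divff // gt_eqF // (bigD1 [ffun=> true]) //= ltr_wpDr ?expR_gt0 //.
by apply: sumr_ge0 => *; exact: expR_ge0.
Qed.

Lemma magnetizationE s : magnetization R s = total_spin s / n%:R.
Proof. by rewrite /magnetization sum_spin mulrC. Qed.

Lemma expect_magnetization_ge b h : 0 <= b -> 0 <= h ->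
  tanh h <= gibbs_expect b h (@magnetization R n).
Proof.
move=> b0 h0.
have k0 : 0 <= b / (2 * n%:R) by rewrite divr_ge0 // mulr_ge0.
have H := mean_spin_ge k0 h0.
pose W s := expR (b / (2 * n%:R) * total_spin s ^+ 2 + h * total_spin s).
have -> : gibbs_expect b h (@magnetization R n) =
    (\sum_s total_spin s * W s) / n%:R / \sum_s W s.
  rewrite 2!mulr_suml; apply: eq_bigr => s _.
  by rewrite gibbsE magnetizationE -/(W s); ring.
rewrite ler_pdivlMr; last first.
  rewrite (bigD1 [ffun=> true]) //= ltr_wpDr ?expR_gt0 //.
  by apply: sumr_ge0 => *; exact: expR_ge0.
by rewrite ler_pdivlMr // mulrC mulrA.
Qed.

End magnetization_mean.

(** * Transfer of the sub-Poisson tails to the magnetization *)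

Theorem proposition4p11 (R : realType) (n : nat) (beta h : R)
    (n_gt0 : (0 < n)%N) (beta_ge0 : 0 <= beta) (beta_lt1 : beta < 1)
    (h_ge0 : 0 <= h) (t : R) (t_ge0 : 0 <= t) :
  gibbs_prob beta h (fun s : config n =>
      magnetization R s >= gibbs_expect beta h (@magnetization R n) + t)
    <= expR (- (n%:R * (1 - beta) * t ^+ 2 /
         (16 * (1 - tanh h + 4 / ((1 - beta) * Num.sqrt n%:R)))))
  /\
  gibbs_prob beta h (fun s : config n =>
      magnetization R s <= gibbs_expect beta h (@magnetization R n) - t)
    <= expR (- (n%:R * (1 - beta) * t ^+ 2 /
         (4 * (1 - tanh h + 4 / ((1 - beta) * Num.sqrt n%:R)) + 4 * t))).
Proof.
have nR_gt0 : 0 < n%:R :> R by rewrite ltr0n.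
have beta'_gt0 : 0 < 1 - beta by rewrite subr_gt0.
pose l : R := - (2 * beta + 2 * h).
pose w (s : config n) := weight n beta l (minus s).
pose X (s : config n) : R := (minus s)%:R.
set v := 1 - tanh h + _.
set M := gibbs_expect beta h (@magnetization R n).
pose mu := laplace w X 1 0 / laplace w X 0 0.
have L0 : laplace w X 0 0 = \sum_s w s.
  by apply: eq_bigr => s _; rewrite mul0r expR0 expr0 !mulr1.
have L1 : laplace w X 1 0 = \sum_s w s * X s.
  by apply: eq_bigr => s _; rewrite mul0r expR0 expr1 !mulr1.
have w_gt0 s : 0 < w s by exact: weight_gt0.
have w_ge0 s : 0 <= w s by rewrite ltW.
have Z_gt0 : 0 < \sum_s w s.
  by rewrite (bigD1 [ffun=> true]) //= ltr_wpDr // sumr_ge0.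
(* The all-minus configuration contributes a positive term since n > 0. *)
have mu_gt0 : 0 < mu.
  rewrite /mu L0 L1 divr_gt0 // (bigD1 [ffun=> false]) //= ltr_pwDl //.
    rewrite mulr_gt0 // /X ltr0n /minus (eq_bigr (fun=> 1%N)) ?sum1_card ?card_ord //.
    by move=> i _; rewrite ffunE.
  by apply: sumr_ge0 => s _; rewrite mulr_ge0 // ler0n.
have ME : M = 1 - 2 * mu / n%:R.
  rewrite /M /gibbs_expect /mu L0 L1.
  transitivity (\sum_s (gibbs beta h s - 2 / n%:R * (w s * X s / \sum_s w s)) : R).
    apply: eq_bigr => s _; rewrite magnetizationE // (gibbs_weightE n_gt0) -/l -/(w s).
    rewrite -/(\sum_s w s) /total_spin /X; field.
    by rewrite !gt_eqF.
  rewrite sumrB gibbs_sum1 // -mulr_sumr -mulr_suml; congr (_ - _).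
  by field; rewrite !gt_eqF.
have mu_le : mu <= n%:R * v / 2.
  have tM : tanh h <= M by exact: expect_magnetization_ge.
  have e0 : 0 <= 4 / ((1 - beta) * Num.sqrt n%:R).
    by rewrite divr_ge0 // mulr_ge0 ?sqrtr_ge0 // ltW.
  have muE : mu = n%:R * (1 - M) / 2 by rewrite ME; field; rewrite gt_eqF.
  by rewrite muE ler_pM2r // ler_pM2l // /v; lra.
have v_gt0 : 0 < v.
  have := lt_le_trans mu_gt0 mu_le.
  by rewrite pmulr_lgt0 // pmulr_rgt0.
pose c := (1 - beta)^-1.
have c_gt0 : 0 < c by rewrite invr_gt0.
have sub : forall u, laplace w X 0 u <=
     laplace w X 0 0 * expR (mu * (expR (c * u) - 1) / c).
  apply: laplace_subpoisson => // [|u].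
    by apply/card_gt0P; exists [ffun=> true].
  (* The tilt by [u] is absorbed into the linear coefficient, so the variance bound at [l + u]
     covers every tilt. *)
  have E k : laplace w X k u =
     \sum_s weight n beta (l + u) (@minus n s) * (minus s)%:R ^+ k.
    apply: eq_bigr => s _; rewrite mulrAC -expRD /X; congr (expR _ * _); ring.
  have := weight_variance n_gt0 (l + u) beta_ge0.
  have E0 : \sum_s weight n beta (l + u) (@minus n s) = laplace w X 0 u.
    by rewrite E; apply: eq_bigr => s _; rewrite expr0 mulr1.
  have E1 : \sum_s weight n beta (l + u) (@minus n s) * (minus s)%:R = laplace w X 1 u.
    by rewrite E; apply: eq_bigr => s _; rewrite expr1.
  by rewrite E0 E1 -E => H; rewrite [leRHS]mulrC /c ler_pdivlMr // [leLHS]mulrC.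
have probE (A : pred (config n)) :
    gibbs_prob beta h A = (\sum_(s | A s) w s) / \sum_s w s.
  rewrite /gibbs_prob mulr_suml; apply: eq_bigr => s _.
  by rewrite (gibbs_weightE n_gt0).
have XE s : X s = (n%:R - n%:R * magnetization R s) / 2.
  by rewrite magnetizationE // /total_spin /X; field; rewrite gt_eqF.
have muE : mu = (n%:R - n%:R * M) / 2 by rewrite ME; field; rewrite gt_eqF.
(* A deviation of [t] for the magnetization is one of [x] in the opposite direction for [X]: the
   upper tail of the one is the left tail of the other. *)
pose x := n%:R * t / 2.
have x_ge0 : 0 <= x by rewrite /x divr_ge0 // mulr_ge0 // ltW.
clearbody mu; split; rewrite probE ler_pdivrMr // mulrC.
- apply: le_trans (subpoisson_left_tail c_gt0 mu_gt0 w_ge0 sub x_ge0 _) _.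
    move=> s; rewrite -(ler_pM2l nR_gt0) mulrDr XE muE /x.
    by lra.
  rewrite ler_pM2l // ler_expR lerN2.
  (* With mu <= n v / 2 the exponent obtained is at least n (1 - beta) t^2 / (8 v), which exceeds or
     equals the one required. *)
  rewrite ler_pdivrMr ?mulr_gt0 // [leRHS]mulrAC ler_pdivlMr ?mulr_gt0 //.
  have -> : n%:R * (1 - beta) * t ^+ 2 * (4 * c * mu) = n%:R * t ^+ 2 * (4 * mu).
    by rewrite /c; field; rewrite gt_eqF.
  have -> : x ^+ 2 * (16 * v) = n%:R * t ^+ 2 * (4 * (n%:R * v)).
    by rewrite /x; field.
  rewrite ler_wpM2l ?mulr_ge0 ?sqr_ge0 //.
  by have := mulr_gt0 nR_gt0 v_gt0; lra.
apply: le_trans (subpoisson_right_tail c_gt0 mu_gt0 w_ge0 sub x_ge0 _) _.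
  move=> s; rewrite -(ler_pM2l nR_gt0) mulrBr XE muE /x.
  by lra.
rewrite ler_pM2l // ler_expR lerN2.
have mux : 0 < mu + x by rewrite ltr_wpDr.
have vt : 0 < 4 * v + 4 * t by rewrite ltr_wpDr ?mulr_ge0 // mulr_gt0.
(* Here 2 (mu + x) <= n (v + t), which gives exactly the denominator 4 v + 4 t. *)
rewrite ler_pdivrMr // [leRHS]mulrAC ler_pdivlMr ?mulr_gt0 //.
have -> : n%:R * (1 - beta) * t ^+ 2 * (2 * c * (mu + x)) = n%:R * t ^+ 2 * (2 * (mu + x)).
  by rewrite /c; field; rewrite gt_eqF.
have -> : x ^+ 2 * (4 * v + 4 * t) = n%:R * t ^+ 2 * (n%:R * v + n%:R * t).
  by rewrite /x; field.
rewrite ler_wpM2l ?mulr_ge0 ?sqr_ge0 // /x.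
by lra.
Qed.
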